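(* Let $R$ be a strictly pro-right-artinian ring. Then any finitely generated submodule of a Hausdorff right $R$-module is closed.
   Context: All rings are unital. A topological ring $R$ is strictly pro-right-artinian if it is isomorphic, as a topological ring, to the inverse limit of an inverse system (indexed by a directed set) of discrete right artinian rings such that the standard map from $R$ to each of these rings is onto. Such a ring is Hausdorff and has a basis of neighborhoods of $0$ consisting of two-sided ideals. Every right $R$-module $M$ is given the standard topology, with basis of neighborhoods $\{x+MJ: J \text{ an open two-sided ideal of } R\}$ at $x\in M$; ''Hausdorff'' and ''closed'' refer to this topology. *)

(* Defs.v *)
From HB Require Import structures.
From mathcomp Require Import all_boot all_order all_algebra.
From mathcomp Require Import all_classical all_reals all_analysis.

Set Implicit Arguments.
Unset Strict Implicit.
Unset Printing Implicit Defensive.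

Import Order.TTheory GRing.Theory.
Local Open Scope classical_set_scope.
Local Open Scope ring_scope.

HB.mixin Record isTopologicalPzRing R & Topological R & GRing.PzRing R := {
  mul_continuous : continuous (fun x : R * R => x.1 * x.2)
}.

#[short(type="topologicalPzRingType")]
HB.structure Definition TopologicalPzRing :=
  {R of TopologicalZmodule R & GRing.PzRing R & isTopologicalPzRing R}.

Section Ideals.
Variable R : pzRingType.

Definition right_ideal (J : set R) : Prop :=
  [/\ J 0, (forall x y, J x -> J y -> J (x + y))
    & (forall x a, J x -> J (x * a))].

Definition two_sided_ideal (J : set R) : Prop :=
  right_ideal J /\ (forall a x, J x -> J (a * x)).

Definition right_artinian : Prop :=
  forall J : nat -> set R, (forall n, right_ideal (J n)) ->
    (forall n, J n.+1 `<=` J n) ->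
    exists N, forall n, (N <= n)%N -> J n = J N.

End Ideals.

Lemma continuous_pairing (X Y Z : topologicalType) (f : X -> Y) (g : X -> Z) :
  continuous f -> continuous g -> continuous (fun u => (f u, g u)).
Proof. by move=> cf cg u; apply: cvg_pair; [exact: cf|exact: cg]. Qed.

Section ProductRing.
Variables (I : Type) (T : I -> topologicalPzRingType).
Local Notation P := (prod_topology T).
Implicit Types x y z : P.

Definition prod_zero : P := fun i => 0.
Definition prod_one : P := fun i => 1.
Definition prod_opp x : P := fun i => - x i.
Definition prod_add x y : P := fun i => x i + y i.
Definition prod_mul x y : P := fun i => x i * y i.

Lemma prod_addA : associative prod_add.
Proof. by move=> x y z; apply: functional_extensionality_dep => i; apply: addrA. Qed.
Lemma prod_addC : commutative prod_add.
Proof. by move=> x y; apply: functional_extensionality_dep => i; apply: addrC. Qed.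
Lemma prod_add0 : left_id prod_zero prod_add.
Proof. by move=> x; apply: functional_extensionality_dep => i; apply: add0r. Qed.
Lemma prod_addN : left_inverse prod_zero prod_opp prod_add.
Proof. by move=> x; apply: functional_extensionality_dep => i; apply: addNr. Qed.
Lemma prod_mulA : associative prod_mul.
Proof. by move=> x y z; apply: functional_extensionality_dep => i; apply: mulrA. Qed.
Lemma prod_mul1l : left_id prod_one prod_mul.
Proof. by move=> x; apply: functional_extensionality_dep => i; apply: mul1r. Qed.
Lemma prod_mul1r : right_id prod_one prod_mul.
Proof. by move=> x; apply: functional_extensionality_dep => i; apply: mulr1. Qed.
Lemma prod_mulDl : left_distributive prod_mul prod_add.
Proof. by move=> x y z; apply: functional_extensionality_dep => i; apply: mulrDl. Qed.
Lemma prod_mulDr : right_distributive prod_mul prod_add.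
Proof. by move=> x y z; apply: functional_extensionality_dep => i; apply: mulrDr. Qed.

HB.instance Definition _ := GRing.isZmodule.Build P
  prod_addA prod_addC prod_add0 prod_addN.
HB.instance Definition _ := GRing.Zmodule_isPzRing.Build P
  prod_mulA prod_mul1l prod_mul1r prod_mulDl prod_mulDr.

Lemma continuous_to_prod (X : topologicalType) (f : X -> P) :
  (forall i, continuous (fun u => f u i)) -> continuous f.
Proof.
move=> cf u; apply/cvg_sup => i.
exact: (@continuous_comp_initial _ X (T i) (fun g : P => g i) f (cf i)).
Qed.

Lemma prod_proj_continuous i : continuous (fun x : P => x i).
Proof.
move=> x; have /cvg_sup/(_ i) xx : nbhs x --> (x : P) by [].
apply: cvg_trans (@initial_continuous P (T i) (fun g => g i) x).
exact: cvg_app xx.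
Qed.

Lemma prod_add_continuous : continuous (fun p : P * P => p.1 + p.2).
Proof.
apply: continuous_to_prod => i p.
apply: (@continuous_comp _ _ _ (fun p : P * P => (p.1 i, p.2 i))
  (fun q : T i * T i => q.1 + q.2)); last exact: add_continuous.
apply: continuous_pairing => q.
  apply: (@continuous_comp _ _ _ fst (fun z : P => z i)); first exact: cvg_fst.
  exact: prod_proj_continuous.
apply: (@continuous_comp _ _ _ snd (fun z : P => z i)); first exact: cvg_snd.
exact: prod_proj_continuous.
Qed.

Lemma prod_opp_continuous : continuous (-%R : P -> P).
Proof.
apply: continuous_to_prod => i p.
apply: (@continuous_comp _ _ _ (fun p : P => p i) (-%R : T i -> T i)).
  exact: prod_proj_continuous.
exact: opp_continuous.
Qed.

Lemma prod_mul_continuous : continuous (fun p : P * P => p.1 * p.2).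
Proof.
apply: continuous_to_prod => i p.
apply: (@continuous_comp _ _ _ (fun p : P * P => (p.1 i, p.2 i))
  (fun q : T i * T i => q.1 * q.2)); last exact: mul_continuous.
apply: continuous_pairing => q.
  apply: (@continuous_comp _ _ _ fst (fun z : P => z i)); first exact: cvg_fst.
  exact: prod_proj_continuous.
apply: (@continuous_comp _ _ _ snd (fun z : P => z i)); first exact: cvg_snd.
exact: prod_proj_continuous.
Qed.

HB.instance Definition _ :=
  PreTopologicalNmodule_isTopologicalNmodule.Build P prod_add_continuous.
HB.instance Definition _ :=
  TopologicalNmodule_isTopologicalZmodule.Build P prod_opp_continuous.
HB.instance Definition _ := isTopologicalPzRing.Build P prod_mul_continuous.

End ProductRing.

Record inverse_system (d : Order.disp_t) (I : preorderType d) := InverseSystem {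
  sys_ring :> I -> topologicalPzRingType;
  sys_map : forall i j : I, (i <= j)%O -> {rmorphism sys_ring j -> sys_ring i};
  sys_map_continuous : forall (i j : I) (ij : (i <= j)%O),
    continuous (sys_map ij);
  sys_map_id : forall (i : I) (ii : (i <= i)%O) (x : sys_ring i),
    sys_map ii x = x;
  sys_map_comp : forall (i j k : I) (ij : (i <= j)%O) (jk : (j <= k)%O)
      (ik : (i <= k)%O) (x : sys_ring k),
    sys_map ij (sys_map jk x) = sys_map ik x
}.

Definition directed (d : Order.disp_t) (I : preorderType d) : Prop :=
  [set: I] !=set0 /\ forall i j : I, exists k : I, (i <= k)%O /\ (j <= k)%O.

Section InverseLimit.
Variables (d : Order.disp_t) (I : preorderType d) (S : inverse_system I).
Local Notation P := (prod_topology (fun i : I => S i)).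

Definition threads : set P :=
  [set x | forall (i j : I) (ij : (i <= j)%O), sys_map S ij (x j) = x i].

(* The subtype of the product ring, with the subspace topology of the product
   topology. *)
Definition inverse_limit : Type := set_type threads.

HB.instance Definition _ := SubType.on inverse_limit.
HB.instance Definition _ := Topological.on inverse_limit.

Lemma threads_subring : subring_closed (mem threads).
Proof.
split=> [|x y /set_mem tx /set_mem ty|x y /set_mem tx /set_mem ty];
  apply/mem_set => i j ij.
- exact: rmorph1.
- by rewrite [LHS](rmorphB (sys_map S ij) (x j) (y j)) tx ty.
- by rewrite [LHS](rmorphM (sys_map S ij) (x j) (y j)) tx ty.
Qed.

HB.instance Definition _ :=
  GRing.SubChoice_isSubPzRing.Build P (mem threads)
    inverse_limit threads_subring.

Local Notation L := inverse_limit.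

Lemma limit_val_continuous : continuous (val : L -> P).
Proof. exact: (@initial_continuous L P set_val). Qed.

Lemma continuous_to_limit (X : topologicalType) (f : X -> L) :
  continuous (fun u => val (f u) : P) -> continuous f.
Proof. exact: (@continuous_comp_initial L X P set_val f). Qed.

Lemma limit_add_continuous : continuous (fun p : L * L => p.1 + p.2).
Proof.
apply: continuous_to_limit => p.
apply: (@continuous_comp _ _ _ (fun p : L * L => (val p.1, val p.2))
  (fun q : P * P => q.1 + q.2)); last exact: add_continuous.
apply: continuous_pairing => q.
  apply: (@continuous_comp _ _ _ fst (val : L -> P)); first exact: cvg_fst.
  exact: limit_val_continuous.
apply: (@continuous_comp _ _ _ snd (val : L -> P)); first exact: cvg_snd.
exact: limit_val_continuous.
Qed.

Lemma limit_opp_continuous : continuous (-%R : L -> L).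
Proof.
apply: continuous_to_limit => p.
apply: (@continuous_comp _ _ _ (val : L -> P) (-%R : P -> P)).
  exact: limit_val_continuous.
exact: opp_continuous.
Qed.

Lemma limit_mul_continuous : continuous (fun p : L * L => p.1 * p.2).
Proof.
apply: continuous_to_limit => p.
apply: (@continuous_comp _ _ _ (fun p : L * L => (val p.1, val p.2))
  (fun q : P * P => q.1 * q.2)); last exact: mul_continuous.
apply: continuous_pairing => q.
  apply: (@continuous_comp _ _ _ fst (val : L -> P)); first exact: cvg_fst.
  exact: limit_val_continuous.
apply: (@continuous_comp _ _ _ snd (val : L -> P)); first exact: cvg_snd.
exact: limit_val_continuous.
Qed.

HB.instance Definition _ :=
  PreTopologicalNmodule_isTopologicalNmodule.Build L limit_add_continuous.
HB.instance Definition _ :=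
  TopologicalNmodule_isTopologicalZmodule.Build L limit_opp_continuous.
HB.instance Definition _ := isTopologicalPzRing.Build L limit_mul_continuous.

Definition limit_proj (i : I) (x : L) : S i := (val x : P) i.

End InverseLimit.

Definition topological_ring_iso (R T : topologicalPzRingType)
    (f : {rmorphism R -> T}) : Prop :=
  continuous f /\ exists g : T -> R, [/\ cancel f g, cancel g f & continuous g].

Definition discrete (T : topologicalType) : Prop :=
  @nbhs T T = principal_filter.

Definition strictly_pro_right_artinian (R : topologicalPzRingType) : Prop :=
  exists (d : Order.disp_t) (I : preorderType d) (S : inverse_system I)
      (f : {rmorphism R -> inverse_limit S}),
    [/\ directed I,
        (forall i, discrete (S i) /\ right_artinian (S i)),
        topological_ring_iso f
      & (forall (i : I) (a : S i), exists r : R, limit_proj i (f r) = a)].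

(* A right R-module is a left module over the converse ring R^c. *)
Section RightModules.
Variables (R : topologicalPzRingType) (M : lmodType R^c).
Implicit Types (N : set M) (J : set R) (x y : M).

Definition rscale x (a : R) : M := (a : R^c) *: x.

Definition submodule N : Prop :=
  [/\ N 0, (forall x y, N x -> N y -> N (x + y))
    & (forall x a, N x -> N (rscale x a))].

Definition finitely_generated N : Prop :=
  exists s : seq M, N = smallest submodule [set` s].

(* The submodule MJ. *)
Definition module_mul J : set M :=
  [set y | exists (n : nat) (x : 'I_n -> M) (a : 'I_n -> R),
     (forall k, J (a k)) /\ y = \sum_(k < n) rscale (x k) (a k)].

Definition open_ideal J : Prop := open J /\ two_sided_ideal J.

Definition std_nbhs x : set_system M :=
  filter_from open_ideal (fun J => [set x + y | y in module_mul J]).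

Lemma module_mul0 J : module_mul J 0.
Proof.
by exists 0, (fun=> 0), (fun=> 0); split; [case|rewrite big_ord0].
Qed.

Lemma module_mulD J x y :
  module_mul J x -> module_mul J y -> module_mul J (x + y).
Proof.
move=> [m [u [a [Ja ->]]]] [n [v [b [Jb ->]]]].
pose w k := match fintype.split k with inl i => u i | inr j => v j end.
pose c k := match fintype.split k with inl i => a i | inr j => b j end.
exists (m + n)%N, w, c; split=> [k|]; first by rewrite /c; case: fintype.split.
rewrite big_split_ord; congr (_ + _); apply: eq_bigr => i _.
  by rewrite /w /c; case: split_ordP => j /eqP; rewrite eq_shift // => /eqP ->.
by rewrite /w /c; case: split_ordP => j /eqP; rewrite eq_shift // => /eqP ->.
Qed.

Lemma module_mulS J J' : J `<=` J' -> module_mul J `<=` module_mul J'.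
Proof.
by move=> JJ' _ [n [x [a [Ja ->]]]]; exists n, x, a; split=> // k; exact/JJ'.
Qed.

Lemma open_idealT : open_ideal setT.
Proof. by split; [exact: openT|]. Qed.

Lemma open_idealI J J' : open_ideal J -> open_ideal J' -> open_ideal (J `&` J').
Proof.
move=> [oJ [[J0 JD JM] Jl]] [oJ' [[J'0 J'D J'M] J'l]]; split; first exact: openI.
split; first split=> //.
- by move=> x y [? ?] [? ?]; split; [apply: JD|apply: J'D].
- by move=> x a [? ?]; split; [apply: JM|apply: J'M].
- by move=> a x [? ?]; split; [apply: Jl|apply: J'l].
Qed.

Lemma std_nbhs_filter x : ProperFilter (std_nbhs x).
Proof.
apply: filter_from_proper; last first.
  by move=> J _; exists x, 0; [exact: module_mul0|rewrite addr0].
apply: filter_from_filter; first by exists setT; exact: open_idealT.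
move=> J J' oJ oJ'; exists (J `&` J'); first exact: open_idealI.
by move=> _ [y JJ'y <-]; split; exists y => //; apply: module_mulS JJ'y => ? [].
Qed.

Lemma std_nbhs_singleton x (A : set M) : std_nbhs x A -> A x.
Proof. by move=> [J _]; apply; exists 0; [exact: module_mul0|rewrite addr0]. Qed.

Lemma std_nbhs_nbhs x (A : set M) : std_nbhs x A -> std_nbhs x (std_nbhs^~ A).
Proof.
move=> [J oJ JA]; exists J => // _ [y Jy <-]; exists J => // _ [z Jz <-].
by apply: JA; exists (y + z); [exact: module_mulD|rewrite addrA].
Qed.

Definition standard_topology : Type := M.

HB.instance Definition _ := GRing.Lmodule.on standard_topology.
HB.instance Definition _ := hasNbhs.Build standard_topology std_nbhs.
HB.instance Definition _ := Nbhs_isNbhsTopological.Build standard_topology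
  std_nbhs_filter std_nbhs_singleton std_nbhs_nbhs.

End RightModules.

(* Main.v *)
(* The key fact is that R is linearly compact as a right module over itself: a
   downward directed family of cosets of open right ideals has a common point.
   Extend the family to a maximal filter of such cosets; by the descending
   chain condition it contains, for each artinian quotient of R, the fibre of a
   point, and these points form a thread.
   If N is a closed submodule and x lies in the closure of N + mR, then the
   sets {a | x - ma in N + MJ}, J an open ideal, are such cosets, and a common
   point a puts x - ma in the closure of N.  So N + mR is closed, and since 0 is
   closed in a Hausdorff module, one concludes by induction on the number of
   generators. *)
Require Import Defs.
From HB Require Import structures.
From mathcomp Require Import all_boot all_order all_algebra.
From mathcomp Require Import all_classical all_reals all_analysis.

Import GRing.Theory.
Local Open Scope classical_set_scope.
Local Open Scope ring_scope.

(** * Cosets of right ideals and the descending chain condition *)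

(* The cosets of right ideals, described without reference to the ideal. *)
Definition right_coset {R : pzRingType} (A : set R) : Prop :=
  A !=set0 /\ forall x y z a, A x -> A y -> A z -> A (x + (y - z) * a).

Lemma right_coset1 {R : pzRingType} (x : R) : right_coset [set x].
Proof.
by split=> [|_ _ _ a -> -> ->]; [exists x|rewrite /= subrr mul0r addr0].
Qed.

Lemma right_cosetI {R : pzRingType} (A B : set R) :
  right_coset A -> right_coset B -> A `&` B !=set0 -> right_coset (A `&` B).
Proof.
move=> [_ Ac] [_ Bc] AB0; split=> // x y z a [Ax Bx] [Ay By] [Az Bz].
by split; [exact: Ac|exact: Bc].
Qed.

Lemma right_coset_preimage {R S : pzRingType} (p : {rmorphism R -> S})
    (A : set S) :
  right_coset A -> p @^-1` A !=set0 -> right_coset (p @^-1` A).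
Proof.
move=> [_ Ac] A0; split=> // x y z a Ax Ay Az.
by rewrite /preimage /= rmorphD rmorphM rmorphB; exact: Ac.
Qed.

Lemma right_coset_image {R S : pzRingType} (p : {rmorphism R -> S})
    (A : set R) :
  (forall s, exists r, p r = s) -> right_coset A -> right_coset (p @` A).
Proof.
move=> psurj [[x0 Ax0] Ac]; split; first by exists (p x0), x0.
move=> _ _ _ b [x Ax <-] [y Ay <-] [z Az <-]; have [a <-] := psurj b.
exists (x + (y - z) * a); first exact: Ac.
by rewrite rmorphD rmorphM rmorphB.
Qed.

(** For a coset [A], this is the right ideal of which [A] is a translate. *)
Definition direction {R : pzRingType} (A : set R) : set R :=
  [set d | exists y z, [/\ A y, A z & d = y - z]].

Lemma right_ideal_direction {R : pzRingType} (A : set R) :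
  right_coset A -> right_ideal (direction A).
Proof.
move=> [[x0 Ax0] Ac]; split.
- by exists x0, x0; rewrite subrr.
- move=> _ _ [y [z [Ay Az ->]]] [y' [z' [Ay' Az' ->]]].
  exists (y + (y' - z') * 1), z; split=> //; first exact: Ac.
  by rewrite mulr1 addrAC.
- move=> _ a [y [z [Ay Az ->]]].
  exists (y + (y - z) * a), y; split=> //; first exact: Ac.
  by rewrite [RHS]addrAC subrr add0r.
Qed.

Lemma subset_direction_eq {R : pzRingType} (A B : set R) :
  right_coset B -> B `<=` A -> direction A `<=` direction B -> B = A.
Proof.
move=> [[b Bb] Bc] BA dAB; apply/seteqP; split=> // x Ax.
have [y [z [By Bz e]]] : direction B (x - b).
  by apply: dAB; exists x, b; split=> //; exact: BA.
by rewrite -(subrK b x) addrC e -(mulr1 (y - z)); exact: Bc.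
Qed.

(** Without a least member, intersecting would yield an infinite strictly descending chain of
    cosets. Nested cosets with equal directions coincide, so the directions would descend strictly
    too, against the chain condition. *)
Lemma right_artinian_min_coset {R : pzRingType} (D : set (set R)) :
  right_artinian R -> D !=set0 -> (forall A, D A -> right_coset A) ->
  (forall A B, D A -> D B -> D (A `&` B)) ->
  exists2 A, D A & forall B, D B -> A `<=` B.
Proof.
move=> art [A0 DA0] Dc DI; apply: contrapT => nomin.
have step (A : {A : set R | D A}) :
    {B : {A : set R | D A} | sval B `<` sval A}.
  apply: cid; case: A => A DA /=; apply: contrapT => noB.
  apply: nomin; exists A => // B DB; apply: contrapT => nAB.
  apply: noB; exists (exist _ (A `&` B) (DI _ _ DA DB)) => /=.
  by split; [exact: subIsetl|apply: contra_not nAB => AAB x /AAB []].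
have [f [_ fS]] := dependent_choice step (exist _ A0 DA0).
have fc n : right_coset (sval (f n)) by exact/Dc/(svalP (f n)).
have [] := art (fun n => direction (sval (f n))).
- by move=> n; exact: right_ideal_direction.
- move=> n _ [y [z [fy fz ->]]].
  by exists y, z; split=> //; exact: (proj1 (fS n)).
move=> n /(_ n.+1 (leqnSn n)) e; have [le nle] := fS n; apply: nle.
by rewrite [X in _ `<=` X](subset_direction_eq _ _ _ le) // e.
Qed.

(** * Linear compactness, from an abstract family of artinian quotients *)

Section LinearCompactness.
Variables (R : topologicalPzRingType) (I : Type) (S : I -> pzRingType).
Variable p : forall i, {rmorphism R -> S i}.
Hypothesis p_surj : forall i s, exists r, p i r = s.
Hypothesis p_open : forall i (A : set (S i)), open (p i @^-1` A).
Hypothesis p_basis : forall (A : set R) x, open A -> A x ->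
  exists i, forall y, p i y = p i x -> A y.
(** Completeness without transition maps: having common preimages pairwise replaces being a
    thread. *)
Hypothesis p_complete : forall a : (forall i, S i),
  (forall i j, exists r, p i r = a i /\ p j r = a j) ->
  exists r, forall i, p i r = a i.
Hypothesis S_artinian : forall i, right_artinian (S i).

Definition open_coset (A : set R) := open A /\ right_coset A.

(** A filter in the poset of open cosets. It is proper automatically, since cosets are nonempty. *)
Definition coset_filter (G : set (set R)) : Prop :=
  [/\ forall A, G A -> open_coset A,
      forall A B, G A -> G B -> G (A `&` B)
    & forall A B, G A -> open_coset B -> A `<=` B -> G B].

Lemma coset_filterI_neq0 G A B :
  coset_filter G -> G A -> G B -> A `&` B !=set0.
Proof. by move=> [Gc GI _] GA GB; have [_ []] := Gc _ (GI _ _ GA GB). Qed.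

Definition coset_filter_from (F : set (set R)) : set (set R) :=
  [set C | open_coset C /\ exists2 A, F A & A `<=` C].

Lemma coset_filter_fromP F :
  (forall A, F A -> A !=set0) ->
  (forall A B, F A -> F B -> exists2 C, F C & C `<=` A `&` B) ->
  coset_filter (coset_filter_from F).
Proof.
move=> F0 FI; split=> [A []//|A B|A B [_ [C FC CA]] Bc AB]; last first.
  by split=> //; exists C => // x /CA /AB.
move=> [[oA cA] [A' FA' A'A]] [[oB cB] [B' FB' B'B]].
have [C FC CAB] := FI _ _ FA' FB'.
have CAB' : C `<=` A `&` B by move=> x /CAB[/A'A ? /B'B].
split; last by exists C.
split; first exact: openI.
by apply: right_cosetI => //; have [x /CAB'] := F0 _ FC; exists x.
Qed.

Lemma maximal_coset_filter F : coset_filter F -> F !=set0 ->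
  exists G, [/\ coset_filter G, F `<=` G
    & forall G', coset_filter G' -> G `<=` G' -> G' `<=` G].
Proof.
move=> cF [F0 FF0].
(* [set0] is admitted because the empty chain has an empty union. *)
pose P G := G = set0 \/ (coset_filter G /\ F `<=` G).
have [K KP Ktot|G [PG Gmax]] := @Zorn_bigcup _ P.
  have [[X [KX X0]]|noX] := pselect (exists X, K X /\ X !=set0); last first.
    left; apply/seteqP; split=> // A [X KX XA].
    by exfalso; apply: noX; exists X; split=> //; exists A.
  have good Y A : K Y -> Y A -> coset_filter Y /\ F `<=` Y.
    by move=> KY YA; case: (KP _ KY) => // Y0; move: YA; rewrite Y0.
  right; split; last first.
    move=> A FA; exists X => //; case: X0 => B XB.
    by have [_] := good _ _ KX XB; apply.
  split=> [A [Y KY YA]|A B [Y KY YA] [Z KZ ZB]|A B [Y KY YA] cB AB].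
  - by have [[Yc _ _] _] := good _ _ KY YA; exact: Yc.
  - have [YZ|ZY] := Ktot _ _ KY KZ.
    + exists Z => //; have [[_ ZI _] _] := good _ _ KZ ZB.
      by apply: ZI => //; exact: YZ.
    + exists Y => //; have [[_ YI _] _] := good _ _ KY YA.
      by apply: YI => //; exact: ZY.
  - by exists Y => //; have [[_ _ YS] _] := good _ _ KY YA; exact: YS YA cB AB.
have PF : P F by right; split.
case: PG => [G0|[cG FG]].
  exfalso; apply: (Gmax F) => //; rewrite G0; split; first exact: sub0set.
  by move=> /(_ _ FF0).
exists G; split=> // G' cG' GG'; apply: contrapT => G'G.
by apply: (Gmax G'); [split|right; split=> //; exact: subset_trans GG'].
Qed.

(* By the descending chain condition, [G] contains a smallest coset pulled back
   from [S i]; by maximality of [G], it is the fibre of any of its points. *)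
Lemma maximal_coset_filter_fiber G i : coset_filter G -> G !=set0 ->
  (forall G', coset_filter G' -> G `<=` G' -> G' `<=` G) ->
  exists s, G (p i @^-1` [set s]).
Proof.
move=> cG [B0 GB0] Gmax; have [Gc GI GS] := cG.
(* The saturation of [B] contains [B], and it is open like every set pulled back from [S i]. *)
have sat B : G B -> G (p i @^-1` (p i @` B)).
  move=> GB; have [_ Bc] := Gc _ GB; apply: (GS B) => //; last first.
    exact: preimage_image.
  split; first exact: p_open.
  apply: right_coset_preimage; first exact: right_coset_image.
  by have [[b Bb] _] := Bc; exists b, b.
pose D : set (set (S i)) := [set A | right_coset A /\ G (p i @^-1` A)].
have [|A [] //|A B [Ac GA] [Bc GB]|A [Ac GA] Amin] :=
  @right_artinian_min_coset _ D (S_artinian i).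
- exists (p i @` B0); split; last exact: sat.
  by apply: right_coset_image => //; exact: (proj2 (Gc _ GB0)).
- split; last by rewrite preimage_setI; exact: GI.
  apply: right_cosetI => //.
  by have [r [Ar Br]] := coset_filterI_neq0 _ _ _ cG GA GB; exists (p i r).
have [[s As] _] := Ac; exists s.
pose fib := p i @^-1` [set s].
have fib0 : fib !=set0 by have [r] := p_surj i s; exists r.
have fibc : right_coset fib.
  by apply: right_coset_preimage fib0; exact: right_coset1.
(* The image of [B] belongs to [D], so it contains the least coset [A] and in particular [s]. *)
have meet B : G B -> B `&` fib !=set0.
  move=> GB; have /Amin/(_ _ As) [b Bb bs] : D (p i @` B).
    split; last exact: sat.
    by apply: right_coset_image => //; exact: (proj2 (Gc _ GB)).
  by exists b.
pose G1 := coset_filter_from [set C | exists2 B, G B & C = B `&` fib].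
have cG1 : coset_filter G1.
  apply: coset_filter_fromP => [_ [B GB ->]|_ _ [B GB ->] [C GC ->]].
    exact: meet.
  exists (B `&` C `&` fib); first by exists (B `&` C) => //; exact: GI.
  by move=> x [[]].
apply: (Gmax G1 cG1).
  by move=> B GB; split; [exact: Gc|exists (B `&` fib); [exists B|move=> x []]].
split; first by split=> //; exact: p_open.
by exists (B0 `&` fib); [exists B0|move=> x []].
Qed.

Lemma linear_compactness (F : set (set R)) :
  F !=set0 -> (forall A, F A -> open_coset A) ->
  (forall A B, F A -> F B -> exists2 C, F C & C `<=` A `&` B) ->
  exists r, forall A, F A -> A r.
Proof.
move=> [A0 FA0] Fc FI.
have cF : coset_filter (coset_filter_from F).
  by apply: coset_filter_fromP => // A /Fc[_ []].
have FF A : F A -> coset_filter_from F A.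
  by move=> FA; split; [exact: Fc|exists A].
have [|G [cG FG Gmax]] := maximal_coset_filter _ cF.
  by exists A0; exact: FF.
have G0 : G !=set0 by exists A0; exact/FG/FF.
have fib i := cid (maximal_coset_filter_fiber G i cG G0 Gmax).
pose a i := sval (fib i).
have Ga i : G (p i @^-1` [set a i]) := svalP (fib i).
(* Any two fibres in [G] meet, so the points [a i] are pairwise compatible. *)
have [i j|r pr] := p_complete a.
  by have [x []] := coset_filterI_neq0 _ _ _ cG (Ga i) (Ga j); exists x.
exists r => A FA; have [oA [[x Ax] Ac]] := Fc _ FA.
have [i Ai] := p_basis _ _ oA Ax.
have [y [Ay /= yi]] := coset_filterI_neq0 _ _ _ cG (FG _ (FF _ FA)) (Ga i).
(* Since [y] and [r] have the same image in [S i], this element lies in the fibre of [x], which [A]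
   contains. The coset law then moves [y] by [r - y] inside [A]. *)
have Az : A (x + r - y).
  by apply: Ai; rewrite rmorphB rmorphD pr yi addrK.
have -> : r = y + (x + r - y - x) * 1.
  by rewrite mulr1 -(addrA x r) (addrC x) addrK (addrC y) subrK.
exact: Ac.
Qed.

End LinearCompactness.

(** * Projections of the inverse limit, and the transfer to [R] *)

Section ProArtinian.
Variables (d : Order.disp_t) (I : preorderType d) (S : inverse_system I).

Lemma limit_proj_zmod_morphism (i : I) :
  zmod_morphism (@limit_proj d I S i).
Proof. by []. Qed.

Lemma limit_proj_monoid_morphism (i : I) :
  monoid_morphism (@limit_proj d I S i).
Proof. by []. Qed.

HB.instance Definition _ (i : I) :=
  GRing.isZmodMorphism.Build _ _ (@limit_proj d I S i)
    (limit_proj_zmod_morphism i).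
HB.instance Definition _ (i : I) :=
  GRing.isMonoidMorphism.Build _ _ (@limit_proj d I S i)
    (limit_proj_monoid_morphism i).

Lemma sys_map_limit_proj (i j : I) (ij : (i <= j)%O) (x : inverse_limit S) :
  sys_map S ij (limit_proj j x) = limit_proj i x.
Proof. exact: (set_mem (valP x)). Qed.

Lemma limit_proj_continuous (i : I) : continuous (@limit_proj d I S i).
Proof.
move=> x; apply: (@continuous_comp _ _ _ (val : inverse_limit S -> _)
  (fun y => y i)); first exact: limit_val_continuous.
exact: prod_proj_continuous.
Qed.

Lemma limit_proj_basis (A : set (inverse_limit S)) (x : inverse_limit S) :
  directed I -> (forall i, discrete (S i)) -> open A -> A x ->
  exists i, forall y, limit_proj i y = limit_proj i x -> A y.
Proof.
move=> [[i0 _] Idir] Sdisc oA Ax.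
pose B (i : I) := [set y : inverse_limit S | limit_proj i y = limit_proj i x].
have FB : Filter (filter_from setT B).
  apply: filter_from_filter; first by exists i0.
  move=> i j _ _; have [k [ik jk]] := Idir i j; exists k => // y yk.
  split; first by rewrite /B /= -!(sys_map_limit_proj _ _ ik) yk.
  by rewrite /B /= -!(sys_map_limit_proj _ _ jk) yk.
(* The fibres through [x], a filter base by directedness, converge to [x] in the product because the
   fibre over [i] fixes coordinate [i]. *)
have cvgP : ((val : inverse_limit S -> _) @ filter_from setT B) -->
    (val x : prod_topology (fun i => S i)).
  apply/cvg_sup => i C [D [[E oE <-] Ex] DC].
  exists i => // y yi; apply: DC; rewrite /preimage /=.
  by have -> : (val y : prod_topology _) i = (val x : prod_topology _) i by [].
have [U oU UA] := oA.
have [|i _ BU] := cvgP U.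
  by apply: open_nbhs_nbhs; split=> //; rewrite -UA in Ax.
by exists i => y yi; rewrite -UA; exact: BU.
Qed.

End ProArtinian.

Lemma open_discrete (T : topologicalType) (A : set T) : discrete T -> open A.
Proof.
move=> dT; rewrite openE => x Ax; rewrite /interior /= dT.
exact/principal_filterP.
Qed.

Lemma strictly_pro_right_artinian_linear_compactness
    (R : topologicalPzRingType) (F : set (set R)) :
  strictly_pro_right_artinian R ->
  F !=set0 -> (forall A, F A -> open_coset R A) ->
  (forall A B, F A -> F B -> exists2 C, F C & C `<=` A `&` B) ->
  exists r, forall A, F A -> A r.
Proof.
move=> [d [I [S [f [Idir Sart [fc [g [fK gK gc]]] psurj]]]]] F0 Fc FI.
pose p i : {rmorphism R -> S i} := @limit_proj d I S i \o f.
apply: (@linear_compactness R I (fun i => S i) p _ _ _ _ _ F F0 Fc FI)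
  => [i s|i A|A x oA Ax|a pa|i].
- exact: psurj.
- apply: open_comp; last by apply: open_discrete; case: (Sart i).
  move=> x _; apply: continuous_comp; first exact: fc.
  exact: limit_proj_continuous.
- have [i Ai] := limit_proj_basis _ _ _ (g @^-1` A) (f x) Idir
    (fun i => proj1 (Sart i))
    (open_comp (fun y _ => gc y) oA) (eq_ind_r A Ax (fK x)).
  by exists i => y pyx; rewrite -(fK y); exact: Ai.
(* A common preimage of [a i] and [a j] forces the transition map to send [a j] to [a i]. *)
- have ta : a \in @threads d I S.
    by apply/mem_set => i j ij; have [r [<- <-]] := pa i j;
       exact: sys_map_limit_proj.
  by exists (g (exist _ a ta)) => i; rewrite /p /= gK.
- by case: (Sart i).
Qed.

(** * Submodules and closedness in the standard topology *)

Section StandardTopology.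
Context {R : topologicalPzRingType} {M : lmodType R^c}.
Implicit Types (N : set M) (J : set R) (x y m : M) (a b : R).

Lemma rscaleDl x a b : rscale x (a + b) = rscale x a + rscale x b.
Proof. exact: scalerDl. Qed.

Lemma rscaleBl x a b : rscale x (a - b) = rscale x a - rscale x b.
Proof. exact: scalerBl. Qed.

Lemma rscaleBr x y a : rscale (x - y) a = rscale x a - rscale y a.
Proof. exact: scalerBr. Qed.

Lemma rscaleA x a b : rscale (rscale x a) b = rscale x (a * b).
Proof. exact: scalerA. Qed.

Lemma rscale1 x : rscale x 1 = x.
Proof. exact: scale1r. Qed.

Lemma rscale0 x : rscale x 0 = 0.
Proof. exact: scale0r. Qed.

Lemma submoduleN {N} : submodule N -> forall x, N x -> N (- x).
Proof.
by move=> [_ _ NZ] x /(NZ x (-1)); rewrite /rscale scaleN1r.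
Qed.

Lemma submoduleB {N} : submodule N -> forall x y, N x -> N y -> N (x - y).
Proof.
move=> sN x y Nx Ny; case: (sN) => _ ND _; apply: ND => //.
exact: submoduleN.
Qed.

Lemma submodule_module_mul J :
  two_sided_ideal J -> submodule (module_mul J : set M).
Proof.
move=> [[_ _ JM] _]; split; [exact: module_mul0|exact: module_mulD|].
move=> _ b [n [u [a [Ja ->]]]]; exists n, u, (fun k => a k * b).
split=> [k|]; first exact: JM.
by rewrite /rscale scaler_sumr; apply: eq_bigr => k _; exact: rscaleA.
Qed.

Lemma module_mul_rscale J x a : J a -> module_mul J (rscale x a).
Proof.
move=> Ja; exists 1%N, (fun=> x), (fun=> a); split=> //.
by rewrite big_ord1.
Qed.

Definition submodule_sum N N' : set M :=
  [set x | exists2 y, N y & N' (x - y)].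

Lemma submodule_sumP N N' :
  submodule N -> submodule N' -> submodule (submodule_sum N N').
Proof.
move=> [N0 ND NZ] [N'0 N'D N'Z]; split.
- by exists 0; rewrite ?subr0.
- move=> x x' [y Ny N'y] [y' Ny' N'y']; exists (y + y'); first exact: ND.
  by rewrite opprD addrACA; exact: N'D.
- move=> x a [y Ny N'y]; exists (rscale y a); first exact: NZ.
  by rewrite -rscaleBr; exact: N'Z.
Qed.

Lemma submodule_sum_closure {N J} x : submodule N -> two_sided_ideal J ->
  submodule_sum N (module_mul J) x ->
  (N `&` [set x + y | y in module_mul J]) !=set0.
Proof.
move=> sN /submodule_module_mul/submoduleN JN [y Ny Jy]; exists y; split=> //.
by exists (- (x - y)); [exact: JN|rewrite opprB addrC subrK].
Qed.

(** The neighbourhood x + MJ meets [N] exactly when x lies in N + MJ, so the closure of [N] is the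
    intersection of the N + MJ. *)
Lemma std_closedP N : submodule N ->
  closed (N : set (standard_topology M)) <->
  forall x, (forall J, open_ideal J -> submodule_sum N (module_mul J) x) -> N x.
Proof.
move=> sN; split=> Ncl x Nx.
  apply: Ncl => B [J oJ JB].
  have [y [Ny xJy]] := submodule_sum_closure x sN (proj2 oJ) (Nx J oJ).
  by exists y; split=> //; exact: JB.
apply: Ncl => J oJ.
have [|y [Ny [z Jz e]]] := Nx [set x + y | y in module_mul J].
  by exists J.
exists y => //; rewrite -e opprD addrA subrr add0r.
by apply: submoduleN => //; apply: submodule_module_mul; exact: (proj2 oJ).
Qed.

Lemma hausdorff_module_mul x : hausdorff_space (standard_topology M) ->
  (forall J, open_ideal J -> module_mul J x) -> x = 0.
Proof.
move=> hM Jx; apply/esym/hM => A B [J oJ JA] [J' _ J'B]; exists x; split.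
  by apply: JA; exists x; [exact: Jx|rewrite add0r].
by apply: J'B; exists 0; [exact: module_mul0|rewrite addr0].
Qed.

(** * Adjoining a generator: the submodules N + mR *)

Definition adjoin m N : set M := [set y | exists a, N (y - rscale m a)].

Lemma submodule_adjoin m N : submodule N -> submodule (adjoin m N).
Proof.
move=> [N0 ND NZ]; split.
- by exists 0; rewrite rscale0 subr0.
- move=> x y [a Nx] [b Ny]; exists (a + b).
  by rewrite rscaleDl opprD addrACA; exact: ND.
- by move=> x b [a Nx]; exists (a * b); rewrite -rscaleA -rscaleBr; exact: NZ.
Qed.

(** Two solutions differ by a scalar sending [m] into [N], and such scalars form a right ideal. That
    ideal contains the open ideal [J], because mJ lies in MJ and hence in [N]. *)
Lemma open_coset_solutions {N J} x m : open_ideal J -> submodule N ->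
  module_mul J `<=` N -> [set a | N (x - rscale m a)] !=set0 ->
  open_coset R [set a | N (x - rscale m a)].
Proof.
move=> [oJ [[J0 _ _] _]] sN JN N0; case: (sN) => _ ND NZ; split; last first.
  split=> // a b c r Na Nb Nc; rewrite /= rscaleDl -rscaleA rscaleBl.
  have -> : rscale m b - rscale m c = (x - rscale m c) - (x - rscale m b).
    by rewrite opprB [RHS]addrC addrA subrK.
  rewrite opprD addrA; apply: submoduleB => //.
  by apply: NZ; exact: submoduleB.
rewrite openE => a Na; rewrite /interior.
have : nbhs a ((fun b => b - a) @^-1` J).
  apply: open_nbhs_nbhs; split; last by rewrite /preimage /= subrr.
  apply: open_comp oJ => b _.
  apply: (@continuous_comp _ _ _ (fun b => (b, - a))
    (fun p : R * R => p.1 + p.2)).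
    by apply: cvg_pair; [exact: cvg_id|exact: cvg_cst].
  exact: add_continuous.
apply: filterS => b Jb /=.
rewrite -(subrK a b) rscaleDl opprD addrCA addrC; apply: submoduleB => //.
exact/JN/module_mul_rscale.
Qed.

Lemma closed_adjoin m N : strictly_pro_right_artinian R -> submodule N ->
  closed (N : set (standard_topology M)) ->
  closed (adjoin m N : set (standard_topology M)).
Proof.
move=> hR sN /(std_closedP _ sN) Ncl.
apply/std_closedP; first exact: submodule_adjoin.
move=> x Nx.
pose T J := [set a | submodule_sum N (module_mul J) (x - rscale m a)].
have TS J J' : J `<=` J' -> T J `<=` T J'.
  by move=> JJ' a [y Ny Jy]; exists y => //; exact: module_mulS Jy.
have [||| a Ta] :=
  @strictly_pro_right_artinian_linear_compactness R
    [set T J | J in open_ideal (R:=R)] hR.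
- by exists (T setT), setT => //; exact: open_idealT.
- move=> _ [J oJ <-].
  have sJ := @submodule_module_mul J (proj2 oJ).
  apply: (@open_coset_solutions (submodule_sum N (module_mul J)) J) => //.
    exact: submodule_sumP.
    by move=> y Jy; exists 0; [case: sN|rewrite subr0].
  (* Nonemptiness: [x] is [y] plus an element of MJ with [y] in N + mR, and the scalar [a] of [y] is
     a solution. *)
  have [y [a Ny] Jy] := Nx J oJ; exists a; exists (y - rscale m a) => //.
  by rewrite opprB addrA subrK.
- move=> _ _ [J oJ <-] [J' oJ' <-]; exists (T (J `&` J')).
    by exists (J `&` J') => //; exact: open_idealI.
  by move=> a Ta; split; apply: TS Ta => // ? [].
exists a; apply: Ncl => J oJ.
by apply: (Ta (T J)); exists J.
Qed.

(** Minimality is carried through the induction so that the closed submodule built can be identified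
    with the one generated by [s]. *)
Lemma closed_span (s : seq M) : strictly_pro_right_artinian R ->
  hausdorff_space (standard_topology M) ->
  exists N, [/\ submodule N, closed (N : set (standard_topology M)),
    [set` s] `<=` N
    & forall N', submodule N' -> [set` s] `<=` N' -> N `<=` N'].
Proof.
move=> hR hM; elim: s => [|m s [N [sN cN sub_N minN]]].
  have s0 : submodule [set 0 : M].
    split=> // [_ _ -> ->|_ a ->]; first exact: addr0.
    exact: scaler0.
  exists [set 0]; split=> //; last by move=> N' [N'0 _ _] _ _ ->.
  apply/std_closedP => // x x0; apply: hausdorff_module_mul => // J /x0.
  by move=> [_ -> ]; rewrite subr0.
exists (adjoin m N); split.
- exact: submodule_adjoin.
- exact: closed_adjoin.
- move=> y /=; rewrite inE => /predU1P[->|ys].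
    by exists 1; rewrite rscale1 subrr; case: sN.
  by exists 0; rewrite rscale0 subr0; exact: sub_N.
- move=> N' sN' sub_N' y [a Ny]; rewrite -(subrK (rscale m a) y).
  have [_ N'D N'Z] := sN'; apply: N'D.
    by apply: minN Ny => // z zs; apply: sub_N'; rewrite /= inE zs orbT.
  by apply/N'Z/sub_N'; rewrite /= inE eqxx.
Qed.

End StandardTopology.

Theorem theorem9p6 (R : topologicalPzRingType)
    (hR : strictly_pro_right_artinian R)
    (M : lmodType R^c) (hM : hausdorff_space (standard_topology M))
    (N : set M) (hN : submodule N) (hfg : finitely_generated N) :
  closed (N : set (standard_topology M)).
Proof.
have [s ->] := hfg; have [N' [sN' cN' sub_N' minN']] := closed_span s hR hM.
have -> // : smallest (@submodule R M) [set` s] = N'.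
apply/seteqP; split=> x; first by apply; split.
by move=> N'x K [sK sub_K]; exact: minN' N'x.
Qed.
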